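(* Let $m$ and $n$ be positive integers larger than $1$. Then \[ S(m,n) \le \Bigl(1+\frac{1}{m-1}\Bigr)^{m-1} \sqrt{m}\, (\sqrt{2})^{m-1} \binom{n+m-1}{m}^{\frac{m-1}{2m}} . \]
   Context: $\mathbb{D}^n=\{z\in\mathbb{C}^n: |z_k|<1,\ k=1,\dots,n\}$ is the open unit polydisc. For multi-indices $\alpha=(\alpha_1,\dots,\alpha_n)$ of non-negative integers, $|\alpha|=\alpha_1+\cdots+\alpha_n$ and $z^\alpha=z_1^{\alpha_1}\cdots z_n^{\alpha_n}$. The Sidon constant $S(m,n)$ is the smallest constant $C$ such that \[ \sum_{|\alpha|=m}|a_\alpha| \le C \sup_{z\in\mathbb{D}^n}\Bigl|\sum_{|\alpha|=m} a_\alpha z^\alpha\Bigr| \] holds for every $m$-homogeneous polynomial $\sum_{|\alpha|=m}a_\alpha z^\alpha$ in $n$ complex variables with complex coefficients. *)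

(* Defs.v *)
From HB Require Import structures.
From mathcomp Require Import all_boot all_order all_algebra.
From mathcomp Require Import classical_sets reals.
From mathcomp Require Import complex mpoly.

Set Implicit Arguments.
Unset Strict Implicit.
Unset Printing Implicit Defensive.
Import Order.TTheory GRing.Theory Num.Theory.
Import ComplexField.Normc.
Local Open Scope ring_scope.
Local Open Scope complex_scope.
Local Open Scope classical_set_scope.

(* [normc : R[i] -> R] is the modulus as an element of R, whereas the library's
   [`|z|] lives in R[i]. *)

Definition polydisc (R : realType) (n : nat) : set ('I_n -> R[i]) :=
  [set z | forall k, normc (z k) < 1].
Arguments polydisc : clear implicits.

Definition coef_sum (R : realType) (n : nat) (p : {mpoly R[i][n]}) : R :=
  \sum_(a <- msupp p) normc p@_a.

Definition polydisc_norm (R : realType) (n : nat) (p : {mpoly R[i][n]}) : R :=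
  sup [set normc p.@[z] | z in polydisc R n].

Definition sidon_bounds (R : realType) (m n : nat) : set R :=
  [set C | forall p : {mpoly R[i][n]},
     p \is m.-homog -> coef_sum p <= C * polydisc_norm p].
Arguments sidon_bounds : clear implicits.

(* [inf] and [sup] are total functions with a junk value on empty or unbounded
   sets: [polydisc_norm_has_sup] and [sidon_constantP] below show that here they
   are a genuine supremum and a genuine minimum. *)
Definition sidon_constant (R : realType) (m n : nat) : R :=
  inf (sidon_bounds R m n).
Arguments sidon_constant : clear implicits.

Section SidonTheory.
Variable R : realType.
Implicit Types m n : nat.

Let normc_ge0 (x : R[i]) : 0 <= normc x.
Proof. by case: x => a b; exact: sqrtr_ge0. Qed.

Let normc_sum (I : Type) (s : seq I) (F : I -> R[i]) :
  normc (\sum_(i <- s) F i) <= \sum_(i <- s) normc (F i).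
Proof.
elim: s => [|i s IHs]; first by rewrite !big_nil normc0.
rewrite !big_cons; apply: le_trans (le_normcD _ _) _.
by rewrite lerD2l.
Qed.

Let normc_prod (I : Type) (s : seq I) (F : I -> R[i]) :
  normc (\prod_(i <- s) F i) = \prod_(i <- s) normc (F i).
Proof.
elim: s => [|i s IHs]; first by rewrite !big_nil normc1.
by rewrite !big_cons normcM IHs.
Qed.

Let normcX (x : R[i]) k : normc (x ^+ k) = normc x ^+ k.
Proof. by elim: k => [|k IHk]; rewrite ?expr0 ?normc1 // !exprS normcM IHk. Qed.

Lemma coef_sum_ge0 n (p : {mpoly R[i][n]}) : 0 <= coef_sum p.
Proof. by apply: sumr_ge0. Qed.

Lemma polydisc_le_coef_sum n (p : {mpoly R[i][n]}) z :
  polydisc R n z -> normc p.@[z] <= coef_sum p.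
Proof.
move=> hz; rewrite mevalE; apply: le_trans (normc_sum _ _) _.
apply: ler_sum => a _; rewrite normcM normc_prod ler_piMr //.
apply: prodr_ile1 => i _.
by rewrite normc_ge0 normcX exprn_ile1 // ltW.
Qed.

Lemma polydisc_norm_has_sup n (p : {mpoly R[i][n]}) :
  has_sup [set normc p.@[z] | z in polydisc R n].
Proof.
split.
  by exists (normc p.@[fun=> 0]); exists (fun=> 0) => // k; rewrite normc0.
by exists (coef_sum p) => _ [z hz <-]; exact: polydisc_le_coef_sum.
Qed.

Lemma polydisc_norm_ub n (p : {mpoly R[i][n]}) z :
  polydisc R n z -> normc p.@[z] <= polydisc_norm p.
Proof.
by move=> hz; apply: ub_le_sup; [case: (polydisc_norm_has_sup p)|exists z].
Qed.

Lemma polydisc_norm_ge0 n (p : {mpoly R[i][n]}) : 0 <= polydisc_norm p.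
Proof.
apply: le_trans (normc_ge0 p.@[fun=> 0]) _.
by apply: polydisc_norm_ub => k; rewrite normc0.
Qed.

(* Coefficients are recovered from finitely many values of the polynomial by
   inverting a Vandermonde matrix with nodes in the unit disc. *)
Let node m : 'rV[R[i]]_m.+1 := \row_k ((k : nat).+2%:R)^-1.
Let W m := invmx (Vandermonde m.+1 (node m)).

Let node_lt1 m k : normc (node m 0 k) < 1.
Proof.
rewrite mxE normcV -[X in normc X]/(1 *+ _) normcMn normc1.
by rewrite invf_lt1 ?ltr0n // ltr1n.
Qed.

Let sumW m (a b : 'I_m.+1) : \sum_k node m 0 k ^+ b * W m k a = (b == a)%:R.
Proof.
have VU : Vandermonde m.+1 (node m) \in unitmx.
  rewrite unitmxE det_Vandermonde unitfE; apply/prodf_neq0 => i _.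
  apply/prodf_neq0 => j ij; rewrite subr_eq0 !mxE.
  rewrite (inj_eq invr_inj) eqr_nat.
  by rewrite !eqSS neq_ltn ij orbT.
have := mulmxV VU => /matrixP /(_ b a); rewrite !mxE => <-.
by apply: eq_bigr => k _; rewrite !mxE.
Qed.

Let dhomog_msupp m n (p : {mpoly R[i][n]}) (b : 'X_{1..n}) :
  p \is m.-homog -> b \in msupp p -> mdeg b = m.
Proof. by move=> /dhomogP h /h. Qed.

Let coefE m n (p : {mpoly R[i][n]}) (a : 'X_{1..n}) :
  p \is m.-homog -> a \in msupp p ->
  p@_a = \sum_(f : {ffun 'I_n -> 'I_m.+1})
           p.@[fun i => node m 0 (f i)] * \prod_i W m (f i) (inord (a i)).
Proof.
move=> hp ha.
have le_m (b : 'X_{1..n}) i : b \in msupp p -> (b i < m.+1)%N.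
  move=> hb; rewrite ltnS -(dhomog_msupp hp hb) mdegE (bigD1 i) //=.
  exact: leq_addr.
under eq_bigr => f _ do rewrite mevalE mulr_suml.
rewrite exchange_big /= (bigD1_seq a) //= [X in _ + X]big1_seq ?addr0; last first.
  move=> b /andP[nab hb].
  under eq_bigr => f _ do rewrite -mulrA -big_split /=.
  rewrite -mulr_sumr.
  rewrite -(bigA_distr_bigA
    (fun i k => node m 0 k ^+ b i * W m k (inord (a i)))) /=.
  have [i nabi] : exists i, b i != a i.
    apply/existsP; rewrite -negb_forall; apply: contra nab => /forallP e.
    by apply/eqP/mnmP => i; apply/eqP.
  rewrite (bigD1 i) //=.
  rewrite -(inordK (le_m b i hb)) sumW.
  rewrite -val_eqE /= !inordK ?le_m //.
  by rewrite (negPf nabi) mul0r mulr0.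
under eq_bigr => f _ do rewrite -mulrA -big_split /=.
rewrite -mulr_sumr -(bigA_distr_bigA
    (fun i k => node m 0 k ^+ a i * W m k (inord (a i)))) /=.
rewrite big1 ?mulr1 // => i _.
by rewrite -{1}(inordK (le_m a i ha)) sumW eqxx.
Qed.

Lemma sidon_bounds_neq0 m n : sidon_bounds R m n !=set0.
Proof.
pose K (a : 'X_{1..n}) : R := \sum_(f : {ffun 'I_n -> 'I_m.+1})
  normc (\prod_i W m (f i) (inord (a i))).
have K0 a : 0 <= K a by apply: sumr_ge0.
exists (\sum_(a : 'X_{1..n < m.+1}) K a) => p hp.
have step : coef_sum p <= (\sum_(a <- msupp p) K a) * polydisc_norm p.
  rewrite mulr_suml [leLHS]big_seq [leRHS]big_seq; apply: ler_sum => a ha.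
  rewrite (coefE hp ha); apply: le_trans (normc_sum _ _) _.
  rewrite mulr_suml; apply: ler_sum => f _.
  rewrite normcM mulrC ler_wpM2l // polydisc_norm_ub // => k; exact: node_lt1.
apply: le_trans step _; apply: ler_wpM2r; first exact: polydisc_norm_ge0.
have le_m b : b \in msupp p -> (mdeg b < m.+1)%N.
  by move=> hb; rewrite (dhomog_msupp hp hb).
rewrite [leRHS](_ : _ = \sum_(b <- map val (enum {: 'X_{1..n < m.+1}})) K b); last first.
  by rewrite big_map big_enum.
rewrite [leRHS](bigID (mem (msupp p))) /= ler_wpDr ?sumr_ge0 //.
rewrite -[leRHS]big_filter le_eqVlt; apply/orP; left; apply/eqP; apply: perm_big.
apply: uniq_perm; rewrite ?filter_uniq // ?(map_inj_uniq val_inj) ?enum_uniq //.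
move=> b; rewrite mem_filter; case: (boolP (b \in msupp p)) => //= hb.
by apply/esym/mapP; exists (BMultinom (le_m b hb)); rewrite ?mem_enum.
Qed.

Lemma sidon_bounds_ge0 m n C : (0 < n)%N -> sidon_bounds R m n C -> 0 <= C.
Proof.
move=> n0 hC; pose p : {mpoly R[i][n]} := 'X_[(U_(Ordinal n0) *+ m)%MM].
have hp : p \is m.-homog by rewrite dhomogX /= mdegMn mdeg1 mul1n.
have := hC p hp; rewrite /coef_sum msuppX big_seq1 mcoeffX eqxx normc1.
rewrite leNgt => h; rewrite leNgt; apply: contra h => C0.
by apply: le_lt_trans (ltr01); rewrite nmulr_rle0 ?polydisc_norm_ge0.
Qed.

Lemma sidon_constantP m n : (0 < n)%N ->
  sidon_bounds R m n (sidon_constant R m n) /\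
  lbound (sidon_bounds R m n) (sidon_constant R m n).
Proof.
move=> n0.
have lb : lbound (sidon_bounds R m n) (sidon_constant R m n).
  move=> C hC; apply: ge_inf => //; exists 0 => D.
  exact: sidon_bounds_ge0.
split=> // p hp; have := polydisc_norm_ge0 p.
rewrite le_eqVlt => /predU1P[s0|s_gt0].
  have [C /(_ p hp)] := sidon_bounds_neq0 m n.
  by rewrite -s0 !mulr0.
rewrite -ler_pdivrMr //; apply: lb_le_inf; first exact: sidon_bounds_neq0.
by move=> C /(_ p hp); rewrite ler_pdivrMr.
Qed.

End SidonTheory.

(* Main.v *)
Require Import Defs.
From mathcomp Require Import all_boot all_order all_algebra.
From mathcomp Require Import cyclic separable cyclotomic.
From mathcomp Require Import boolp reals exp complex mpoly.
From mathcomp Require Import ring lra zify.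

(* Let [q_l] be the partial derivatives of [p], of degree [d = m - 1].  Euler's
   identity gives [m * coef_sum p = sum_l coef_sum q_l], and by Cauchy-Schwarz
   each [coef_sum q_l] is at most [sqrt N' * |q_l|_2], where
   [N' = 'C(n + m - 2, m - 1)] counts the monomials of degree [d].  The torus
   inequality [|f|_2 <= (sqrt 2)^d * |f|_1] for [d]-homogeneous [f] (Weissler,
   Bayart) bounds [sum_l |q_l|_2] by the mean of [sum_l |q_l|], and on the torus
   [sum_l |q_l| <= m (m / (m - 1))^(m - 1) * polydisc_norm p] by Cauchy's
   estimate on complex lines.  Finally [sqrt N'] is at most
   [sqrt m * N^((m - 1) / (2 m))] with [N = 'C(n + m - 1, m)], as
   [N' <= (n + m - 1)^(m - 1)] and [m N = (n + m - 1) N'].  Differentiating first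
   thus makes Blei's mixed-norm inequality unnecessary. *)

Set Implicit Arguments.
Unset Strict Implicit.
Unset Printing Implicit Defensive.
Import Order.TTheory GRing.Theory Num.Theory.
Import ComplexField.Normc.
Local Open Scope ring_scope.
Local Open Scope complex_scope.

Section SidonBound.
Variable R : realType.
Local Notation C := R[i].
Implicit Types (x z w : C) (p f h : {poly C}) (g : C -> R).

(** * Moduli of complex numbers and roots of unity *)

Lemma normc_ge0 x : 0 <= normc x.
Proof. by case: x => a b; exact: sqrtr_ge0. Qed.

Lemma normcX x k : normc (x ^+ k) = normc x ^+ k.
Proof. by elim: k => [|k IHk]; rewrite ?expr0 ?normc1 // !exprS normcM IHk. Qed.

Lemma normc_real (r : R) : 0 <= r -> normc r%:C = r.
Proof. by move=> r0; rewrite /normc /= expr0n addr0 sqrtr_sqr ger0_norm. Qed.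

Lemma normc_sum (I : Type) (s : seq I) (F : I -> C) :
  normc (\sum_(i <- s) F i) <= \sum_(i <- s) normc (F i).
Proof.
elim: s => [|i s IHs]; first by rewrite !big_nil normc0.
by rewrite !big_cons (le_trans (le_normcD _ _)) // lerD2l.
Qed.

Lemma normc_sqr x : (normc x ^+ 2)%:C = x * Num.conj x.
Proof. by rewrite -sqr_normc normc_def; case: x => a b; rewrite rmorphXn. Qed.

Lemma normc_prim_root N w : N.-primitive_root w -> normc w = 1.
Proof.
move=> wN; have N0 := prim_order_gt0 wN.
have := congr1 (@normc R) (prim_expr_order wN).
by rewrite normcX normc1 => /eqP; rewrite pexpr_eq1 // ?normc_ge0 // => /eqP.
Qed.

Lemma prim_root_exists N : (0 < N)%N -> exists w : C, N.-primitive_root w.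
Proof.
move=> N0; have [r Dp] := closed_field_poly_normal ('X^N - 1 : {poly C}).
rewrite (monicP _) ?monicXnsubC // scale1r in Dp.
have rn1 : all N.-unity_root r.
  by apply/allP=> z; rewrite -root_prod_XsubC -Dp.
have sz_r : (N < (size r).+1)%N.
  by rewrite -(size_prod_XsubC r id) -Dp size_XnsubC.
have [|z] := hasP (has_prim_root N0 rn1 _ sz_r); last by exists z.
by rewrite -separable_prod_XsubC -Dp separable_Xn_sub_1 // pnatr_eq0 -lt0n.
Qed.

Lemma sum_unity_root N x : x ^+ N = 1 -> x != 1 -> \sum_(j < N) x ^+ j = 0.
Proof.
move=> xN x1; apply: (mulfI (_ : x - 1 != 0)); first by rewrite subr_eq0.
by rewrite -subrX1 xN subrr mulr0.
Qed.

(** * Averages over roots of unity in place of circle integrals *)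

Definition circle_mean N w g : R := (\sum_(j < N) g (w ^+ j)) / N%:R.

Lemma le_circle_mean N w g g' : N.-primitive_root w ->
  (forall z, normc z = 1 -> g z <= g' z) ->
  circle_mean N w g <= circle_mean N w g'.
Proof.
move=> wN gg'; rewrite ler_wpM2r ?invr_ge0 ?ler0n //.
by apply: ler_sum => j _; rewrite gg' // normcX (normc_prim_root wN) expr1n.
Qed.

Lemma circle_mean_cst N w (c : R) :
  N.-primitive_root w -> circle_mean N w (fun=> c) = c.
Proof.
move=> /prim_order_gt0 N0; rewrite /circle_mean sumr_const card_ord.
rewrite -[c *+ N]mulr_natr.
by rewrite mulfK // pnatr_eq0 -lt0n.
Qed.

Lemma circle_meanD N w g g' :
  circle_mean N w (fun z => g z + g' z) = circle_mean N w g + circle_mean N w g'.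
Proof. by rewrite /circle_mean big_split mulrDl. Qed.

Lemma circle_meanZ N w (a : R) g :
  circle_mean N w (fun z => a * g z) = a * circle_mean N w g.
Proof. by rewrite /circle_mean -mulr_sumr mulrA. Qed.

(** Orthogonality of characters: the size bound keeps all exponents below [N], so distinct ones stay
    distinct modulo [N] and the discrete mean is exact. *)
Lemma parseval N w f : N.-primitive_root w -> (size f <= N)%N ->
  circle_mean N w (fun z => normc f.[z] ^+ 2) = \sum_(k < N) normc f`_k ^+ 2.
Proof.
move=> wN fN; have N0 := prim_order_gt0 wN.
have NR0 : N%:R != 0 :> R by rewrite pnatr_eq0 -lt0n.
apply: (mulIf NR0); rewrite /circle_mean divfK //.
apply: (@complexI R); rewrite rmorphM !rmorph_sum /=.
have w0 : w != 0.
  apply/eqP => w0; have := oner_neq0 R.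
  by rewrite -(normc_prim_root wN) w0 normc0 eqxx.
have wJ : Num.conj w = w^-1.
  apply: (mulfI w0); rewrite divff // -normc_sqr (normc_prim_root wN).
  by rewrite expr1n.
have expand j : (normc f.[w ^+ j] ^+ 2)%:C =
    \sum_(k < N) \sum_(l < N) f`_k * Num.conj f`_l * (w ^+ k / w ^+ l) ^+ j.
  rewrite normc_sqr (horner_coef_wide _ fN) rmorph_sum mulr_suml.
  apply: eq_bigr => k _; rewrite mulr_sumr; apply: eq_bigr => l _.
  rewrite rmorphM !rmorphXn /=.
  rewrite wJ exprMn !exprVn -!exprM.
  by rewrite ![(_ * j)%N]mulnC mulrACA.
under eq_bigr do rewrite expand.
rewrite exchange_big mulr_suml /=.
apply: eq_bigr => k _; rewrite exchange_big (bigD1 k) //= [X in _ + X]big1 ?addr0.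
  rewrite divff ?expf_neq0 // normc_sqr -mulr_sumr; congr (_ * _).
  under eq_bigr do rewrite expr1n.
  by rewrite sumr_const card_ord rmorph_nat.
move=> l lk; rewrite -mulr_sumr sum_unity_root ?mulr0 //.
  by rewrite exprMn exprVn -!exprM ![(_ * N)%N]mulnC !exprM (prim_expr_order wN)
             !expr1n divr1.
apply: contra lk => /eqP /(congr1 (fun t => t * w ^+ l)).
rewrite divfK ?expf_neq0 // mul1r => /eqP.
by rewrite (eq_prim_root_expr wN) !modn_small // => /eqP kl; apply/eqP/val_inj.
Qed.

Lemma coef_dilate f (a : C) k : (f \Po (a *: 'X))`_k = f`_k * a ^+ k.
Proof.
elim/poly_ind: f k => [|f c IH] k; first by rewrite comp_poly0 !coef0 mul0r.
rewrite comp_polyD comp_polyM comp_polyX comp_polyC !coefD !coefC.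
rewrite -scalerAr coefZ !coefMX; case: k => [|k] /=.
  by rewrite mulr0 expr0 mulr1.
by rewrite !addr0 IH exprS mulrCA.
Qed.

Lemma size_dilate f (a : C) : (size (f \Po (a *: 'X)) <= size f)%N.
Proof.
by apply/leq_sizeP => j fj; rewrite coef_dilate nth_default ?mul0r.
Qed.

Lemma horner_dilate f (a z : C) : (f \Po (a *: 'X)).[z] = f.[a * z].
Proof. by rewrite horner_comp hornerZ hornerX. Qed.

(** A single term of the Parseval sum of [fr] is at most the mean square of [f] on the circle of
    radius [r], hence at most [M ^+ 2]. *)
Lemma cauchy_coef f k (r M : R) : 0 < r ->
  (forall z, normc z = r -> normc f.[z] <= M) -> normc f`_k * r ^+ k <= M.
Proof.
move=> r0 fM; pose N := maxn (size f) k.+1.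
have [w wN] : exists w : C, N.-primitive_root w.
  by apply: prim_root_exists; rewrite leq_max orbT.
pose fr := f \Po (r%:C *: 'X).
have frN : (size fr <= N)%N.
  by apply: leq_trans (size_dilate _ _) _; rewrite leq_maxl.
have M0 : 0 <= M.
  by apply: le_trans (fM r%:C _); rewrite ?normc_ge0 ?normc_real // ltW.
have kN : (k < N)%N by rewrite leq_max leqnn orbT.
rewrite -(normc_real (ltW r0)) -normcX -normcM -coef_dilate -/fr.
rewrite -(@ler_pXn2r _ 2) ?nnegrE ?normc_ge0 //.
apply: (@le_trans _ _ (\sum_(j < N) normc fr`_j ^+ 2)).
  by rewrite (bigD1 (Ordinal kN)) //= lerDl sumr_ge0 // => j _; rewrite sqr_ge0.
rewrite -(parseval wN frN) -(circle_mean_cst (M ^+ 2) wN).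
apply: le_circle_mean => // z z1.
rewrite horner_dilate ler_pXn2r ?nnegrE ?normc_ge0 //.
by rewrite fM // normcM normc_real ?z1 ?mulr1 // ltW.
Qed.

(** * Polynomials that are nearly squares on the closed disc *)

(** Polynomial substitute for the holomorphic square root of a function without zeros in the open
    disc. *)
Definition sqrt_approx f := forall e : R, 0 < e -> exists h,
  forall z, normc z <= 1 -> normc (f.[z] - h.[z] ^+ 2) <= e.

Lemma disc_bound f :
  exists2 M : R, 0 <= M & forall z, normc z <= 1 -> normc f.[z] <= M.
Proof.
exists (\sum_(k < size f) normc f`_k).
  by apply: sumr_ge0 => k _; exact: normc_ge0.
move=> z z1; rewrite horner_coef (le_trans (normc_sum _ _)) // ler_sum // => k _.
by rewrite normcM normcX ler_piMr ?normc_ge0 // exprn_ile1 // normc_ge0.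
Qed.

Lemma sqrt_approxC (c : C) : sqrt_approx c%:P.
Proof.
move=> e e0; exists (sqrtC c)%:P => z _.
by rewrite !hornerC sqrtCK subrr normc0 ltW.
Qed.

Lemma sqrt_approxM f1 f2 :
  sqrt_approx f1 -> sqrt_approx f2 -> sqrt_approx (f1 * f2).
Proof.
move=> A1 A2 e e0.
have [M1 M10 fM1] := disc_bound f1; have [M2 M20 fM2] := disc_bound f2.
(* The bound [d <= 1] gives [normc u <= M1 + 1]; the total error is then at most
   [d * (M1 + M2 + 1)]. *)
pose d := Num.min 1 (e / (M1 + M2 + 1)).
have d0 : 0 < d by rewrite lt_min ltr01 divr_gt0 //; lra.
have d1 : d <= 1 by rewrite ge_min lexx.
have de : d * (M1 + M2 + 1) <= e.
  by rewrite -ler_pdivlMr ?ge_min ?lexx ?orbT //; lra.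
have [h1 H1] := A1 d d0; have [h2 H2] := A2 d d0.
exists (h1 * h2) => z z1; rewrite !hornerM exprMn.
set a := f1.[z]; set b := f2.[z]; set u := h1.[z] ^+ 2; set v := h2.[z] ^+ 2.
have -> : a * b - u * v = (a - u) * b + (a - (a - u)) * (b - v) by ring.
apply: le_trans (le_normcD _ _) _; rewrite !normcM.
have h1' : normc (a - u) <= d by exact: H1.
have h2' : normc (b - v) <= d by exact: H2.
have ha : normc a <= M1 by exact: fM1.
have hb : normc b <= M2 by exact: fM2.
have hau : normc (a - (a - u)) <= M1 + 1.
  apply: le_trans (le_normcD _ _) _; rewrite normcN.
  by apply: lerD => //; apply: le_trans h1' _.
apply: le_trans de.
have -> : d * (M1 + M2 + 1) = d * M2 + (M1 + 1) * d by ring.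
by apply: lerD; apply: ler_pM; rewrite ?normc_ge0.
Qed.

(* The iteration [y := (x + y^2)/2] converges to [1 - sqrt (1 - x)]. *)
Lemma sqrt_approx_lin (a : C) : normc a <= 1 -> sqrt_approx (1 - a *: 'X).
Proof.
move=> a1 e e0.
(* The iteration at [x = 1]. It dominates the iterates for every [x] in the closed disc, and also
   their increments. *)
pose t j : R := iter j (fun y => 2^-1 * (1 + y ^+ 2)) 0.
have tS j : t j.+1 = 2^-1 * (1 + t j ^+ 2) by [].
have t01 j : 0 <= t j <= 1.
  elim: j => [|j /andP[IH0 IH1]]; first by rewrite /t /= lexx ler01.
  rewrite tS; nra.
pose q (x : C) j : C := iter j (fun y => 2^-1 * (x + y ^+ 2)) 0.
have qS x j : q x j.+1 = 2^-1 * (x + q x j ^+ 2) by [].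
have half : normc (2^-1 : C) = 2^-1.
  by rewrite normcV -[2 in LHS]/(1 *+ 2) normcMn normc1.
have qt x j : normc x <= 1 -> normc (q x j) <= t j.
  move=> x1; elim: j => [|j IH]; first by rewrite normc0.
  rewrite qS tS normcM half ler_pM2l ?invr_gt0 ?ltr0n //.
  apply: le_trans (le_normcD _ _) _; apply: lerD => //.
  by rewrite normcX ler_pXn2r ?nnegrE ?normc_ge0 //; case/andP: (t01 j).
have qd x j : normc x <= 1 -> normc (q x j.+1 - q x j) <= t j.+1 - t j.
  move=> x1; elim: j => [|j IH].
    rewrite qS tS /q /t /iter !expr0n !addr0 !subr0 normcM half mulr1.
    by rewrite ler_piMr ?invr_ge0 ?ler0n.
  have -> : q x j.+2 - q x j.+1
      = 2^-1 * ((q x j.+1 - q x j) * (q x j.+1 + q x j)).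
    by rewrite !qS; field.
  have -> : t j.+2 - t j.+1 = 2^-1 * ((t j.+1 - t j) * (t j.+1 + t j)).
    by rewrite !tS; field.
  rewrite !normcM half ler_pM2l ?invr_gt0 ?ltr0n //.
  apply: ler_pM; rewrite ?normc_ge0 //.
  by apply: le_trans (le_normcD _ _) (lerD _ _); apply: qt.
(* As [t] stays at most 1, its increments cannot all exceed [e / 2]. *)
have [j tj] : exists j, 2 * (t j.+1 - t j) <= e.
  apply/not_existsP => tj.
  have grow j : e * j%:R <= 2 * t j.
    elim: j => [|j IH]; first by rewrite mulr0 /t /= mulr0.
    have /negP := tj j; rewrite -ltNge => tj'.
    rewrite -natr1 mulrDr mulr1; lra.
  have := archi_boundP (_ : 0 <= 2 / e); rewrite divr_ge0 ?ltW // => /(_ isT).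
  rewrite ltr_pdivrMr // => bd; have := grow (Num.bound (2 / e)).
  have /andP[_] := t01 (Num.bound (2 / e)); lra.
pose P i : {poly C} := iter i (fun y => (2^-1)%:P * (a *: 'X + y ^+ 2)) 0.
have PE i z : (P i).[z] = q (a * z) i.
  elim: i => [|i IH]; first by rewrite /P /q /= horner0.
  by rewrite /P /= -/(P i) !hornerE /= IH.
exists (1 - P j) => z z1; rewrite !hornerE /= PE; set x := a * z.
(* The defect of the square is, up to sign, twice an increment of the iteration. *)
have -> : 1 - x - (1 - q x j) ^+ 2 = - (2 * (q x j.+1 - q x j)).
  by rewrite qS; field.
rewrite normcN normcM [normc 2](_ : _ = 2); last first.
  by rewrite -[2]mulr1 mulr_natl normcMn normc1.
apply: le_trans tj; rewrite ler_pM2l ?ltr0n //; apply: qd.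
by rewrite normcM mulr_ile1 ?normc_ge0.
Qed.

(* Zeros inside the disc are reflected in the unit circle, where this does not
   change the modulus; inside the disc it only increases. *)
Lemma zero_free_majorant f : exists g : {poly C}, [/\ sqrt_approx g,
  forall z, normc z = 1 -> normc f.[z] = normc g.[z] &
  forall z, normc z <= 1 -> normc f.[z] <= normc g.[z]].
Proof.
have [r ->] := closed_field_poly_normal f.
elim: r (lead_coef f) => {f} [|a r IH] c.
  by rewrite big_nil alg_polyC; exists c%:P; split=> //; exact: sqrt_approxC.
have [g [Ag g1 gle]] := IH c.
suff [l [Al l1 lle]] : exists l, [/\ sqrt_approx l,
    forall z, normc z = 1 -> normc ('X - a%:P).[z] = normc l.[z] &
    forall z, normc z <= 1 -> normc ('X - a%:P).[z] <= normc l.[z]].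
  exists (l * g); rewrite big_cons scalerAr; split; first exact: sqrt_approxM.
    by move=> z z1; rewrite !hornerM !normcM l1 // g1.
  by move=> z z1; rewrite !hornerM !normcM ler_pM ?normc_ge0 ?lle ?gle.
have [a1|a1] := ltP (normc a) 1; last first.
  exists ('X - a%:P); split=> //.
  have a0 : a != 0.
    by apply/eqP => a0; move: a1; rewrite a0 normc0 lt_geF ?ltr01.
  have -> : 'X - a%:P = (- a)%:P * (1 - a^-1 *: 'X).
    rewrite mul_polyC scalerBr scalerA mulNr mulfV // scaleN1r opprK.
    by rewrite addrC alg_polyC polyCN.
  apply: sqrt_approxM; [exact: sqrt_approxC | apply: sqrt_approx_lin].
  by rewrite normcV invf_le1 // (lt_le_trans ltr01).
(* The last summand vanishes for [normc z = 1] and is nonnegative inside the disc, which gives both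
   comparisons. *)
have ident z : normc (1 - (a^* *: 'X) : {poly C}).[z] ^+ 2 =
    normc (z - a) ^+ 2 + (1 - normc a ^+ 2) * (1 - normc z ^+ 2).
  rewrite !hornerE; case: a z {a1} => [b c'] [x y].
  rewrite /normc /= !sqr_sqrtr ?addr_ge0 ?sqr_ge0 //; ring.
exists (1 - a^* *: 'X); split.
- apply: sqrt_approx_lin; have : normc a = normc (a^*).
    by case: (a) => b c'; rewrite /normc /= sqrrN.
  by move=> <-; exact: ltW.
- move=> z z1; apply/eqP; rewrite -(@eqrXn2 _ 2) ?normc_ge0 //.
  by rewrite ident hornerXsubC z1 expr1n subrr mulr0 addr0.
- move=> z z1; rewrite -(@ler_pXn2r _ 2) ?nnegrE ?normc_ge0 // ident.
  rewrite hornerXsubC lerDl mulr_ge0 // subr_ge0 exprn_ile1 ?normc_ge0 //.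
  exact: ltW.
Qed.

(** * The weighted inequality in one variable *)

Lemma cauchy_schwarz (I : Type) (s : seq I) (a b : I -> R) :
  (\sum_(i <- s) a i * b i) ^+ 2 <=
    (\sum_(i <- s) a i ^+ 2) * (\sum_(i <- s) b i ^+ 2).
Proof.
elim: s => [|i s IH]; first by rewrite !big_nil expr0n mul0r.
rewrite !big_cons; move: IH.
set X := \sum_(_ <- s) _ * _; set A := \sum_(_ <- s) a _ ^+ 2.
set B := \sum_(_ <- s) b _ ^+ 2 => XAB.
have A0 : 0 <= A by apply: sumr_ge0 => j _; rewrite sqr_ge0.
have B0 : 0 <= B by apply: sumr_ge0 => j _; rewrite sqr_ge0.
have [x0 y0] := (sqr_ge0 (a i), sqr_ge0 (b i)).
(* The square of the left side is at most [4 * A * B * (a i * b i) ^+ 2]; the arithmetic-geometric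
   mean inequality does the rest. *)
have cross : 2 * X * (a i * b i) <= A * b i ^+ 2 + B * a i ^+ 2.
  apply: le_trans (ler_norm _) _.
  rewrite -(@ler_pXn2r _ 2) ?nnegrE //; last first.
    by apply: addr_ge0; apply: mulr_ge0.
  rewrite real_normK ?num_real //.
  have : 0 <= (A * b i ^+ 2 - B * a i ^+ 2) ^+ 2 by rewrite sqr_ge0.
  have : X ^+ 2 * (a i * b i) ^+ 2 <= A * B * (a i * b i) ^+ 2.
    by rewrite ler_wpM2r ?sqr_ge0.
  lra.
have -> : (a i * b i + X) ^+ 2 =
  a i ^+ 2 * b i ^+ 2 + 2 * X * (a i * b i) + X ^+ 2 by ring.
have -> : (a i ^+ 2 + A) * (b i ^+ 2 + B) =
  a i ^+ 2 * b i ^+ 2 + (A * b i ^+ 2 + B * a i ^+ 2) + A * B by ring.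
by rewrite !lerD.
Qed.

(** Cauchy-Schwarz over the [k + 1] terms of the convolution costs a factor [k + 1 <= 2 ^ k]. The
    weight [2^-1], and with it the final [sqrt 2], comes from here. *)
Lemma coef_sqr_le h k : 2^-1 ^+ k * normc (h ^+ 2)`_k ^+ 2 <=
  \sum_(i < k.+1) normc h`_i ^+ 2 * normc h`_(k - i) ^+ 2.
Proof.
have cs : normc (h ^+ 2)`_k ^+ 2 <=
    k.+1%:R * \sum_(i < k.+1) normc h`_i ^+ 2 * normc h`_(k - i) ^+ 2.
  have -> : k.+1%:R = \sum_(i < k.+1) 1 ^+ 2 :> R.
    by rewrite expr1n sumr_const card_ord.
  under [X in _ <= _ * X]eq_bigr do rewrite -exprMn.
  apply: le_trans (cauchy_schwarz _ _ _).
  have sum_ge0 : 0 <= \sum_(i < k.+1) 1 * (normc h`_i * normc h`_(k - i)).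
    by apply: sumr_ge0 => i _; rewrite mul1r mulr_ge0 ?normc_ge0.
  rewrite ler_pXn2r ?nnegrE ?normc_ge0 // expr2 coefM.
  apply: le_trans (normc_sum _ _) _; apply: ler_sum => i _.
  by rewrite normcM mul1r.
rewrite exprVn ler_pdivrMl ?exprn_gt0 //; apply: le_trans cs _.
apply: ler_wpM2r; last by rewrite -natrX ler_nat ltn_expl.
by apply: sumr_ge0 => i _; rewrite mulr_ge0 ?sqr_ge0.
Qed.

(** The right side of [coef_sqr_le] is a coefficient of [u ^+ 2], where [u] carries the squared
    moduli of the coefficients of [h]; summing amounts to evaluating [u ^+ 2] at 1. *)
Lemma sum_coef_sqr h N :
  \sum_(k < N) 2^-1 ^+ k * normc (h ^+ 2)`_k ^+ 2 <=
    (\sum_(k < size h) normc h`_k ^+ 2) ^+ 2.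
Proof.
pose u : {poly R} := \poly_(k < size h) normc h`_k ^+ 2.
have uE k : u`_k = normc h`_k ^+ 2.
  rewrite coef_poly; case: ltnP => // kh.
  by rewrite nth_default // normc0 expr0n.
have u2E k : (u ^+ 2)`_k =
    \sum_(i < k.+1) normc h`_i ^+ 2 * normc h`_(k - i) ^+ 2.
  by rewrite expr2 coefM; apply: eq_bigr => i _; rewrite !uE.
have -> : (\sum_(k < size h) normc h`_k ^+ 2) ^+ 2 = (u ^+ 2).[1].
  rewrite horner_exp horner_poly; congr (_ ^+ 2).
  by apply: eq_bigr => k _; rewrite expr1n mulr1.
rewrite (horner_coef_wide _ (leq_addl N _)).
rewrite big_split_ord /= ler_wpDr ?sumr_ge0 //.
  move=> k _; rewrite expr1n mulr1 u2E sumr_ge0 // => i _.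
  by rewrite mulr_ge0 ?sqr_ge0.
by apply: ler_sum => k _; rewrite expr1n mulr1 u2E coef_sqr_le.
Qed.

(** A lower integral over the circle: [c] is at most the lower limit of the means, and no limit has
    to exist. *)
Definition lower_mean g c := forall e, 0 < e -> exists N0, forall N w,
  (N0 <= N)%N -> N.-primitive_root w -> c - e <= circle_mean N w g.

(* With [g] as in [zero_free_majorant] and [g ~ h^2], the mean of [|f| = |g|]
   is close to [H = sum |h_k|^2], while the mean of [|f|^2 <= |g|^2] over the
   circle of radius [1/sqrt 2] is at most [sum 2^-k |(h^2)_k|^2 <= H^2], as
   [(h^2)_k] has [k + 1 <= 2^k] terms. *)
Lemma lower_mean_normc f K : (size f <= K)%N ->
  lower_mean (fun z => normc f.[z])
    (Num.sqrt (\sum_(k < K) 2^-1 ^+ k * normc f`_k ^+ 2)).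
Proof.
move=> fK e e0; have [g [Ag g1 gle]] := zero_free_majorant f.
pose d := e / 2; have d0 : 0 < d by rewrite divr_gt0.
(* From this size on, Parseval is exact for [f], [h] and [h ^+ 2]. *)
have [h hg] := Ag _ d0; exists (K + size h + size (h ^+ 2))%N => N w NN wN.
have fN : (size f <= N)%N by lia.
have hN : (size h <= N)%N by lia.
have h2N : (size (h ^+ 2) <= N)%N by lia.
set S := Num.sqrt _; set H := \sum_(k < size h) normc h`_k ^+ 2.
have H0 : 0 <= H by rewrite sumr_ge0 // => k _; rewrite sqr_ge0.
have wide (c : nat -> R) p n : (size p <= n)%N ->
    \sum_(k < n) c k * normc p`_k ^+ 2 =
    \sum_(k < size p) c k * normc p`_k ^+ 2.
  move=> pn; rewrite -!(big_mkord xpredT (fun k => c k * normc p`_k ^+ 2)).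
  rewrite (big_cat_nat _ pn) //= [X in _ + X]big_nat_cond.
  rewrite [X in _ + X]big1 ?addr0 //.
  move=> k; rewrite andbT => /andP[pk _].
  by rewrite nth_default // normc0 expr0n mulr0.
have HN : circle_mean N w (fun z => normc h.[z] ^+ 2) = H.
  rewrite parseval //; have := wide (fun=> 1) _ _ hN.
  by under eq_bigr do rewrite mul1r; under [RHS]eq_bigr do rewrite mul1r.
have fH : H - d <= circle_mean N w (fun z => normc f.[z]).
  rewrite -HN -(circle_mean_cst (- d) wN) -circle_meanD.
  apply: le_circle_mean => // z z1; rewrite g1 // lerBlDr -normcX.
  have -> : h.[z] ^+ 2 = g.[z] + - (g.[z] - h.[z] ^+ 2) by ring.
  by apply: le_trans (le_normcD _ _) _; rewrite normcN lerD2l hg ?z1.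
(* One [d] is lost in [fH], the other in [SH]; together they make [e]. *)
suff SH : S <= H + d by rewrite /d in fH SH; lra.
pose r : R := Num.sqrt 2^-1.
have r2 : r ^+ 2 = 2^-1 by rewrite sqr_sqrtr // invr_ge0.
have r0 : 0 <= r by exact: sqrtr_ge0.
have r1 : r <= 1 by rewrite -(@ler_pXn2r _ 2) ?nnegrE // r2; lra.
have radius p : (size p <= N)%N ->
    circle_mean N w (fun z => normc p.[r%:C * z] ^+ 2) =
    \sum_(k < N) 2^-1 ^+ k * normc p`_k ^+ 2.
  move=> pN.
  have := parseval wN (leq_trans (size_dilate p r%:C) pN).
  under [in RHS]eq_bigr do
    rewrite coef_dilate normcM normcX normc_real // exprMn exprAC r2 mulrC.
  by move=> <-; congr (_ / _); apply: eq_bigr => j _; rewrite horner_dilate.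
have S2 : S ^+ 2 = circle_mean N w (fun z => normc f.[r%:C * z] ^+ 2).
  rewrite radius // sqr_sqrtr.
    exact: etrans (wide (fun k => 2^-1 ^+ k) _ _ fK)
      (esym (wide (fun k => 2^-1 ^+ k) _ _ fN)).
  by apply: sumr_ge0 => k _; rewrite mulr_ge0 ?sqr_ge0 ?exprn_ge0 ?invr_ge0.
have H2 : circle_mean N w (fun z => normc h.[r%:C * z] ^+ 2) <= H.
  rewrite radius // -HN parseval //; apply: ler_sum => k _.
  by rewrite ler_piMl ?sqr_ge0 // exprn_ile1 ?invr_ge0 // invf_le1 ?ltr0n ?ler1n.
have H4 : circle_mean N w (fun z => normc (h ^+ 2).[r%:C * z] ^+ 2) <= H ^+ 2.
  by rewrite radius // sum_coef_sqr.
have Hd0 : 0 <= H + d by rewrite addr_ge0 // ltW.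
rewrite -(@ler_pXn2r _ 2) ?nnegrE ?sqrtr_ge0 // S2.
(* The integrand is the expansion of [(normc h ^+ 2 + d) ^+ 2] at [r z]; its mean is at most
   [(H + d) ^+ 2] by [H2] and [H4]. *)
apply: (@le_trans _ _ (circle_mean N w (fun z =>
    (normc (h ^+ 2).[r%:C * z] ^+ 2 + 2 * d * normc h.[r%:C * z] ^+ 2)
    + d ^+ 2))).
  apply: le_circle_mean => // z z1.
  have rz : normc (r%:C * z) <= 1 by rewrite normcM normc_real // z1 mulr1.
  rewrite horner_exp normcX -exprM.
  have -> : normc h.[r%:C * z] ^+ (2 * 2) + 2 * d * normc h.[r%:C * z] ^+ 2
    + d ^+ 2 = (normc h.[r%:C * z] ^+ 2 + d) ^+ 2 by ring.
  rewrite ler_pXn2r ?nnegrE ?normc_ge0 //; last first.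
    by rewrite addr_ge0 ?sqr_ge0 // ltW.
  apply: le_trans (gle _ rz) _; rewrite -normcX.
  set x := _ * z; have -> : g.[x] = h.[x] ^+ 2 + (g.[x] - h.[x] ^+ 2) by ring.
  by apply: le_trans (le_normcD _ _) _; rewrite lerD2l hg.
rewrite !circle_meanD circle_meanZ circle_mean_cst //.
have -> : (H + d) ^+ 2 = H ^+ 2 + 2 * d * H + d ^+ 2 by ring.
by rewrite lerD2r lerD // ler_pM2l // mulr_gt0.
Qed.

(** * Lower means and their iteration over the torus *)

Lemma lower_mean_le g g' c c' : (forall z, normc z = 1 -> g z <= g' z) ->
  c' <= c -> lower_mean g c -> lower_mean g' c'.
Proof.
move=> gg' cc' gc e /gc[N0 gN]; exists N0 => N w NN wN.
apply: le_trans (le_circle_mean wN gg'); apply: le_trans (gN N w NN wN).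
by rewrite lerD2r.
Qed.

Lemma lower_meanD g g' c c' : lower_mean g c -> lower_mean g' c' ->
  lower_mean (fun z => g z + g' z) (c + c').
Proof.
move=> gc gc' e e0; have e20 : 0 < e / 2 by rewrite divr_gt0.
have [N1 H1] := gc _ e20; have [N2 H2] := gc' _ e20.
exists (maxn N1 N2) => N w; rewrite geq_max => /andP[NN1 NN2] wN.
rewrite circle_meanD; move: (H1 N w NN1 wN) (H2 N w NN2 wN); lra.
Qed.

Lemma lower_meanZ (a : R) g c : 0 <= a -> lower_mean g c ->
  lower_mean (fun z => a * g z) (a * c).
Proof.
rewrite le_eqVlt => /predU1P[<- _ e e0|a0 gc e e0].
  exists 0 => N w _ wN; rewrite circle_meanZ !mul0r; lra.
have [N0 H] := gc _ (divr_gt0 e0 a0); exists N0 => N w NN wN.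
have -> : a * c - e = a * (c - e / a).
  by rewrite mulrBr mulrCA divff ?mulr1 ?gt_eqF.
by rewrite circle_meanZ ler_pM2l // H.
Qed.

Lemma lower_mean_ub g c M : (forall z, normc z = 1 -> g z <= M) ->
  lower_mean g c -> c <= M.
Proof.
move=> gM gc; apply/ler_addgt0Pr => e /gc[N0 H].
have [w wN] := prim_root_exists (ltn0Sn N0).
rewrite -[M](circle_mean_cst M wN); have := H _ _ (leqnSn N0) wN.
by rewrite lerBlDr => /le_trans; apply; rewrite lerD2r; exact: le_circle_mean.
Qed.

Definition torus n (s : seq C) := (size s == n) && all (fun z => normc z == 1) s.

(* [torus_mean n g c] says that [c] is at most an iterated lower integral of [g]
   over the torus. As a relation it needs no boundedness or measurability. *)
Fixpoint torus_mean n (g : seq C -> R) (c : R) : Prop :=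
  if n is n'.+1 then
    exists2 g' : seq C -> R,
      forall s, torus n' s -> lower_mean (fun z => g (z :: s)) (g' s) &
      torus_mean n' g' c
  else c <= g [::].

Lemma torus_cons n z s : normc z = 1 -> torus n s -> torus n.+1 (z :: s).
Proof. by rewrite /torus /= eqSS => -> /andP[-> ->]; rewrite eqxx. Qed.

Lemma torus_mean_le n (g g' : seq C -> R) c c' :
  (forall s, torus n s -> g s <= g' s) ->
  c' <= c -> torus_mean n g c -> torus_mean n g' c'.
Proof.
elim: n g g' c c' => [|n IH] g g' c c' gg' cc' /=.
  by move=> gc; apply: le_trans cc' (le_trans gc _); exact: gg'.
move=> [k gk kc]; exists k; last exact: IH kc.
by move=> s ns; apply: lower_mean_le (gk s ns) => // z z1; exact/gg'/torus_cons.
Qed.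

Lemma torus_meanD n (g g' : seq C -> R) c c' :
  torus_mean n g c -> torus_mean n g' c' ->
  torus_mean n (fun s => g s + g' s) (c + c').
Proof.
elim: n g g' c c' => [|n IH] g g' c c' /=; first exact: lerD.
move=> [k gk kc] [k' gk' kc']; exists (fun s => k s + k' s); last exact: IH.
by move=> s ns; apply: lower_meanD; [exact: gk | exact: gk'].
Qed.

Lemma torus_meanZ n (a : R) (g : seq C -> R) c : 0 <= a -> torus_mean n g c ->
  torus_mean n (fun s => a * g s) (a * c).
Proof.
move=> a0; elim: n g c => [|n IH] g c /=; first exact: ler_wpM2l.
move=> [k gk kc]; exists (fun s => a * k s); last exact: IH.
by move=> s ns; apply: lower_meanZ => //; exact: gk.
Qed.

Lemma torus_mean0 n : torus_mean n (fun=> 0) 0.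
Proof.
elim: n => [|n IH] //=; exists (fun=> 0) => // s _ e e0.
exists 0 => N w _ wN; rewrite circle_mean_cst //; lra.
Qed.

Lemma torus_mean_sum n (I : Type) (r : seq I) (g : I -> seq C -> R)
    (c : I -> R) : (forall i, torus_mean n (g i) (c i)) ->
  torus_mean n (fun s => \sum_(i <- r) g i s) (\sum_(i <- r) c i).
Proof.
move=> gc; elim: r => [|i r IH].
  rewrite big_nil; apply: torus_mean_le (torus_mean0 n) => // s _.
  by rewrite big_nil.
rewrite big_cons; apply: torus_mean_le (torus_meanD (gc i) IH) => // s _.
by rewrite big_cons.
Qed.

Lemma torus_mean_ub n (g : seq C -> R) c M : (forall s, torus n s -> g s <= M) ->
  torus_mean n g c -> c <= M.
Proof.
elim: n g c => [|n IH] g c gM /=; first by move=> /le_trans; apply; exact: gM.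
move=> [k gk kc]; apply: IH kc => s ns; apply: lower_mean_ub (gk s ns) => z z1.
exact/gM/torus_cons.
Qed.

(** * The torus inequality in several variables *)

(** Arranged as a polynomial in the first variable over the others, since [torus_mean] averages the
    first variable first. *)
Fixpoint nested_sum D n (c : seq nat -> C) (s : seq C) : C :=
  if n is n'.+1 then
    \sum_(k < D) nested_sum D n' (c \o cons (k : nat)) (behead s) * s`_0 ^+ k
  else c [::].

(** By Parseval, the mean square of [nested_sum] on the torus of radius [1 / sqrt 2]. *)
Fixpoint weight_norm D n (c : seq nat -> C) : R :=
  if n is n'.+1 then
    \sum_(k < D) 2^-1 ^+ k * weight_norm D n' (c \o cons (k : nat))
  else normc (c [::]) ^+ 2.

Lemma weight_norm_ge0 D n c : 0 <= weight_norm D n c.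
Proof.
elim: n c => [|n IH] c /=; first exact: sqr_ge0.
by apply: sumr_ge0 => k _; rewrite mulr_ge0 ?exprn_ge0 ?invr_ge0.
Qed.

(* The one-variable inequality in the first coordinate, then Minkowski's
   inequality in the form of a duality with weights [u k]. *)
Lemma torus_mean_nested_sum D n c :
  torus_mean n (fun s => normc (nested_sum D n c s))
    (Num.sqrt (weight_norm D n c)).
Proof.
elim: n c => [|n IH] c /=; first by rewrite sqrtr_sqr ger0_norm ?normc_ge0.
pose f k s := nested_sum D n (c \o cons k) s.
pose L s := Num.sqrt (\sum_(k < D) 2^-1 ^+ k * normc (f k s) ^+ 2).
exists L => [s ns|].
  pose p := \poly_(k < D) f k s.
  have pE k : (k < D)%N -> p`_k = f k s by move=> kD; rewrite coef_poly kD.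
  apply: lower_mean_le (lower_mean_normc (size_poly D (f ^~ s))).
    by move=> z _; rewrite horner_poly.
  rewrite le_eqVlt; apply/orP; left; apply/eqP; congr Num.sqrt.
  by apply: eq_bigr => k _; rewrite -/p pE.
pose v k := weight_norm D n (c \o cons k).
have v0 k : 0 <= v k by exact: weight_norm_ge0.
set W := \sum_(k < D) _.
have W0 : 0 <= W.
  apply: sumr_ge0 => k _.
  by rewrite mulr_ge0 ?weight_norm_ge0 ?exprn_ge0 ?invr_ge0.
(* The weights [u] divide by [Num.sqrt W], so [W = 0] is treated apart. *)
have [Wz|Wnz] := eqVneq W 0.
  rewrite Wz sqrtr0; apply: torus_mean_le (torus_mean0 n) => // s _.
  exact: sqrtr_ge0.
have sW : 0 < Num.sqrt W by rewrite sqrtr_gt0 lt_neqAle eq_sym Wnz.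
(* Extremal weights for the duality: the [u k * Num.sqrt (v k)] add up to [Num.sqrt W], while the
   [u k * normc (f k s)] add up to at most [L s] by Cauchy-Schwarz. *)
pose u k := 2^-1 ^+ k * Num.sqrt (v k) / Num.sqrt W.
have u0 k : 0 <= u k.
  by rewrite divr_ge0 ?mulr_ge0 ?sqrtr_ge0 ?exprn_ge0 ?invr_ge0.
pose g (k : 'I_D) s := u k * normc (f k s).
apply: torus_mean_le (torus_mean_sum (index_enum 'I_D)
  (fun k : 'I_D => torus_meanZ (u0 k) (IH (c \o cons (k : nat))))); last first.
  have -> : Num.sqrt W = W / Num.sqrt W.
    by rewrite -[X in X / _](sqr_sqrtr W0) expr2 mulfK ?gt_eqF.
  rewrite /W mulr_suml; apply: ler_sum => k _; rewrite -/(v k) /u.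
  have vv : v k = Num.sqrt (v k) * Num.sqrt (v k) by rewrite -expr2 sqr_sqrtr.
  by rewrite [in leLHS]vv mulrA [leRHS]mulrAC.
move=> s ns; under eq_bigr do rewrite -/(f _ s) /u mulrAC.
rewrite -mulr_suml ler_pdivrMr //.
pose r : R := Num.sqrt 2^-1.
have r2 k : (r ^+ k) ^+ 2 = 2^-1 ^+ k by rewrite exprAC sqr_sqrtr ?invr_ge0.
have -> : \sum_(k < D) 2^-1 ^+ k * Num.sqrt (v k) * normc (f k s) =
    \sum_(k < D) (r ^+ k * normc (f k s)) * (r ^+ k * Num.sqrt (v k)).
  by apply: eq_bigr => k _; rewrite -r2; ring.
rewrite -(@ler_pXn2r _ 2) ?nnegrE ?mulr_ge0 ?sqrtr_ge0 //; last first.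
  apply: sumr_ge0 => k _.
  by rewrite !mulr_ge0 ?exprn_ge0 ?sqrtr_ge0 ?normc_ge0.
apply: le_trans (cauchy_schwarz _ _ _) _.
rewrite exprMn !sqr_sqrtr //; last first.
  by apply: sumr_ge0 => k _; rewrite mulr_ge0 ?exprn_ge0 ?invr_ge0 ?normc_ge0.
rewrite le_eqVlt; apply/orP; left; apply/eqP; congr (_ * _).
  by apply: eq_bigr => k _; rewrite exprMn r2.
by apply: eq_bigr => k _; rewrite exprMn r2 sqr_sqrtr.
Qed.

Lemma sum_tuple_cons (T : finType) (V : nmodType) n (F : n.+1.-tuple T -> V) :
  \sum_t F t = \sum_k \sum_(t : n.-tuple T) F [tuple of k :: t].
Proof.
rewrite pair_big /= (reindex (fun u : T * n.-tuple T => [tuple of u.1 :: u.2])) //.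
exists (fun t => (thead t, [tuple of behead t])) => [[k t]|t] _ /=.
  by congr (_, _); apply: val_inj.
by rewrite [RHS]tuple_eta.
Qed.

Lemma sum_tuple0 (T : finType) (V : nmodType) (F : 0.-tuple T -> V) :
  \sum_t F t = F [tuple].
Proof. by rewrite (big_pred1 [tuple]) // => t; rewrite [t]tuple0 /= eqxx. Qed.

Lemma nested_sumE D n (c : seq nat -> C) (s : seq C) : nested_sum D n c s =
  \sum_(t : n.-tuple 'I_D) c (map val t) * \prod_(i < n) s`_i ^+ tnth t i.
Proof.
elim: n c s => [|n IH] c s; first by rewrite sum_tuple0 big_ord0 mulr1.
rewrite sum_tuple_cons /=; apply: eq_bigr => k _; rewrite IH mulr_suml.
apply: eq_bigr => t _; rewrite big_ord_recl tnth0 -mulrA [_ * s`_0 ^+ _]mulrC.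
congr (_ * (_ * _)); apply: eq_bigr => i _.
by rewrite nth_behead tnthS.
Qed.

Lemma weight_normE D n (c : seq nat -> C) : weight_norm D n c =
  \sum_(t : n.-tuple 'I_D)
     2^-1 ^+ (\sum_i tnth t i) * normc (c (map val t)) ^+ 2.
Proof.
elim: n c => [|n IH] c; first by rewrite sum_tuple0 big_ord0 mul1r.
rewrite sum_tuple_cons /=; apply: eq_bigr => k _; rewrite IH mulr_sumr.
apply: eq_bigr => t _; rewrite mulrA -exprD big_ord_recl tnth0.
by under [in RHS]eq_bigr do rewrite tnthS.
Qed.

(** Exponent tuples embed into the monomials. The first hypothesis puts the whole support in the
    image, the second makes all other tuples contribute 0. *)
Lemma sum_msupp_tuple (V : nmodType) n (p : {mpoly C[n]}) D (F : 'X_{1..n} -> V) :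
  (forall a i, a \in msupp p -> a i < D)%N ->
  (forall a, a \notin msupp p -> F a = 0) ->
  \sum_(a <- msupp p) F a =
    \sum_(t : n.-tuple 'I_D) F [multinom (tnth t i : nat) | i < n].
Proof.
move=> pD F0; pose M (t : n.-tuple 'I_D) := [multinom (tnth t i : nat) | i < n].
have Minj : injective M.
  move=> t u /mnmP tu; apply: eq_from_tnth => i; apply: val_inj.
  by have := tu i; rewrite !mnmE.
have -> : \sum_t F (M t) = \sum_(a <- map M (enum {: n.-tuple 'I_D})) F a.
  by rewrite big_map big_enum.
rewrite [RHS](bigID (mem (msupp p))) /= [X in _ + X]big1 ?addr0 //.
rewrite -[RHS]big_filter; apply: perm_big; apply: uniq_perm.
- exact: msupp_uniq.
- by rewrite filter_uniq // map_inj_uniq // enum_uniq.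
move=> a; rewrite mem_filter; case: (boolP (a \in msupp p)) => //= ap.
apply/esym/mapP; exists [tuple Ordinal (pD a i ap) | i < n].
  by rewrite mem_enum.
by apply/mnmP => i; rewrite mnmE tnth_mktuple.
Qed.

(* Each variable contributes a factor [2^-1] per degree, hence the total weight
   [2^-d] of a [d]-homogeneous polynomial. *)
Lemma torus_mean_mpoly n d (p : {mpoly C[n]}) : p \is d.-homog ->
  torus_mean n (fun s => normc p.@[fun i => s`_i])
    (Num.sqrt (2^-1 ^+ d * \sum_(a <- msupp p) normc p@_a ^+ 2)).
Proof.
move=> hp; pose c (s : seq nat) := p@_[multinom nth 0%N s i | i < n].
have pd a : a \in msupp p -> mdeg a = d by exact: dhomog_mf hp a.
have pD a i : a \in msupp p -> (a i < d.+1)%N.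
  by move=> /pd <-; rewrite ltnS mdegE (bigD1 i) //= leq_addr.
have cE (t : n.-tuple 'I_d.+1) :
    c (map val t) = p@_[multinom (tnth t i : nat) | i < n].
  congr mcoeff; apply/mnmP => i; rewrite !mnmE (tnth_nth (tnth t i)).
  by rewrite (nth_map (tnth t i)) ?size_tuple.
apply: torus_mean_le (torus_mean_nested_sum d.+1 n c).
  move=> s _; rewrite nested_sumE mevalE (sum_msupp_tuple pD); last first.
    by move=> a /memN_msupp_eq0 ->; rewrite mul0r.
  rewrite le_eqVlt; apply/orP; left; apply/eqP; congr normc.
  by apply: eq_bigr => t _; rewrite cE; under [in RHS]eq_bigr do rewrite mnmE.
rewrite le_eqVlt; apply/orP; left; apply/eqP; congr Num.sqrt.
rewrite weight_normE mulr_sumr (sum_msupp_tuple pD); last first.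
  by move=> a /memN_msupp_eq0 ->; rewrite normc0 expr0n mulr0.
apply: eq_bigr => t _; rewrite cE; set a := [multinom _ | _ < _].
have [/pd|/memN_msupp_eq0 ->] := boolP (a \in msupp p); last first.
  by rewrite normc0 expr0n !mulr0.
rewrite mdegE => da; congr (_ ^+ _ * _); apply: etrans (esym da) _.
by apply: eq_bigr => i _; rewrite mnmE.
Qed.

(** * Homogeneous polynomials on closed polydiscs and on complex lines *)

Lemma meval_homog n m (p : {mpoly C[n]}) (t : C) (z : 'I_n -> C) :
  p \is m.-homog -> p.@[fun i => t * z i] = t ^+ m * p.@[z].
Proof.
move=> hp; rewrite !mevalE mulr_sumr !big_seq; apply: eq_bigr => a ap.
rewrite -(dhomog_mf hp ap : mdeg a = m) mdegE -prodrXr mulrCA -big_split /=.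
congr (_ * _).
by apply: eq_bigr => i _; rewrite exprMn.
Qed.

Lemma bernoulli (d : R) k : 0 <= d <= 1 -> 1 - k%:R * d <= (1 - d) ^+ k.
Proof.
move=> d01; elim: k => [|k IH]; first by rewrite mul0r subr0 expr0.
have : (1 - d) * (1 - k%:R * d) <= (1 - d) ^+ k.+1.
  by rewrite exprS ler_wpM2l //; lra.
have : 0 <= (k%:R : R) * d ^+ 2 by rewrite mulr_ge0 ?sqr_ge0.
rewrite -natr1; lra.
Qed.

(** Let [t] decrease to [s]. For [a > 0] take [t = s / (1 - d)]: Bernoulli's inequality gives
    [(1 - m d) a <= s ^+ m * b], with [d] small against [e]. *)
Lemma le_expr_limit (a b s : R) m : 0 < s ->
  (forall t, s < t -> a <= t ^+ m * b) -> a <= s ^+ m * b.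
Proof.
move=> s0 H; have [a0|a0] := leP a 0.
  have b0 : 0 <= s ^+ m * b \/ b < 0.
    have [b0|b0] := leP 0 b; [left | by right].
    by rewrite mulr_ge0 // exprn_ge0 // ltW.
  case: b0 => [/(le_trans a0) //|b0].
  have s1 : s < s + 1 by rewrite ltrDl.
  apply: le_trans (H _ s1) _; apply: ler_wnM2r; first exact: ltW.
  by apply: lerXn2r; rewrite ?nnegrE ?ltW // addr_gt0.
apply/ler_addgt0Pr => e e0.
pose d := Num.min 2^-1 (e / (m%:R * a + 1)).
have ma0 : 0 < m%:R * a + 1 by rewrite ltr_wpDl // mulr_ge0 // ltW.
have d0 : 0 < d by rewrite lt_min invr_gt0 ltr0n divr_gt0.
have d1 : d <= 2^-1 by rewrite ge_min lexx.
have d1' : 0 < 1 - d by lra.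
have de : d * (m%:R * a + 1) <= e by rewrite -ler_pdivlMr // ge_min lexx orbT.
have st : s < s / (1 - d) by rewrite ltr_pdivlMr // gtr_pMr //; lra.
have dm : 1 - m%:R * d <= (1 - d) ^+ m by apply: bernoulli; lra.
have : (1 - d) ^+ m * a <= s ^+ m * b.
  rewrite mulrC -ler_pdivlMr ?exprn_gt0 // mulrAC -expr_div_n.
  exact: H.
have : (1 - m%:R * d) * a <= (1 - d) ^+ m * a by rewrite ler_wpM2r // ltW.
lra.
Qed.

(** For [t > s] the point [z / t] lies in the open polydisc; homogeneity restores [t ^+ m], and [t]
    tends to [s]. *)
Lemma normc_meval_le n m (p : {mpoly C[n]}) (z : 'I_n -> C) (s : R) :
  p \is m.-homog -> 0 < s -> (forall i, normc (z i) <= s) ->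
  normc p.@[z] <= s ^+ m * polydisc_norm p.
Proof.
move=> hp s0 zs; apply: le_expr_limit => // t st.
have t0 : 0 < t by exact: lt_trans st.
have tC0 : t%:C != 0 by rewrite eq_complex /= eqxx andbT gt_eqF.
have -> : p.@[z] = t%:C ^+ m * p.@[fun i => (t%:C)^-1 * z i].
  rewrite -meval_homog //; apply: meval_eq => i.
  by rewrite mulrA divff // mul1r.
rewrite normcM normcX (normc_real (ltW t0)) ler_pM2l ?exprn_gt0 //.
apply: polydisc_norm_ub => i; rewrite normcM normcV (normc_real (ltW t0)).
by rewrite mulrC ltr_pdivrMr // mul1r (le_lt_trans (zs i)).
Qed.

(** The chain rule at [t = 0]: it holds for constants and variables and is stable under sums and
    products, hence holds for every polynomial. *)
Lemma line_restriction n (p : {mpoly C[n]}) (z w : 'I_n -> C) :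
  exists2 f, forall t, f.[t] = p.@[fun i => z i + t * w i] &
    f`_1 = \sum_l w l * (p^`M(l)).@[z].
Proof.
pose P (q : {mpoly C[n]}) :=
  exists2 f, forall t, f.[t] = q.@[fun i => z i + t * w i] &
    f`_1 = \sum_l w l * (q^`M(l)).@[z].
have PC c : P c%:MP.
  exists c%:P => [t|]; first by rewrite hornerC mevalC.
  by rewrite coefC big1 // => l _; rewrite mderivC meval0 mulr0.
have PD q q' : P q -> P q' -> P (q + q').
  move=> [f fE f1] [f' fE' f1']; exists (f + f') => [t|].
    by rewrite hornerD mevalD fE fE'.
  rewrite coefD f1 f1' -big_split; apply: eq_bigr => l _ /=.
  by rewrite mderivD mevalD mulrDr.
have at0 q f : (forall t, f.[t] = q.@[fun i => z i + t * w i]) -> f`_0 = q.@[z].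
  move=> fE; rewrite -horner_coef0 fE; apply: meval_eq => i.
  by rewrite mul0r addr0.
have PM q q' : P q -> P q' -> P (q * q').
  move=> [f fE f1] [f' fE' f1']; exists (f * f') => [t|].
    by rewrite hornerM mevalM fE fE'.
  rewrite coefM big_ord_recl big_ord1 /= f1 f1' (at0 _ _ fE) (at0 _ _ fE').
  rewrite mulr_sumr mulr_suml -big_split; apply: eq_bigr => l _ /=.
  rewrite mderivM mevalD !mevalM [RHS]mulrDr [RHS]addrC.
  by congr (_ + _); [rewrite mulrCA | rewrite mulrA].
have PX i : P 'X_i.
  exists ((z i)%:P + w i *: 'X) => [t|].
    by rewrite !hornerE mevalXU mulrC.
  rewrite coefD coefC coefZ coefX mulr1 add0r (bigD1 i) //= big1 ?addr0.
    rewrite mderivX mnm1E eqxx scale1r.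
    have -> : (U_(i) - U_(i) = 0 :> 'X_{1..n})%MM.
      by apply/mnmP => j; rewrite mnmBE subnn mnm0E.
    by rewrite mpolyX0 meval1 mulr1.
  move=> l li; rewrite mderivX mnm1E eq_sym (negPf li) scale0r meval0.
  by rewrite mulr0.
suff : P p by [].
move: P PC PD PM PX {at0} => P PC PD PM PX.
apply: (@mpolyind n _ P) => [|c a q _ _ Pq].
  by have := PC 0; rewrite mpolyC0.
apply: (PD) (Pq); rewrite -mul_mpolyC; apply: (PM) (PC c) _; rewrite mpolyXE_id.
have P1 : P 1 by have := PC 1; rewrite mpolyC1.
apply: (big_ind P P1 PM) => i _.
by elim: (a i) => [|k Pk]; rewrite ?expr0 // exprS; exact: PM (PX i) Pk.
Qed.

(* Restrict [p] to the line [z + t w] with unimodular [w l] such that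
   [w l * p_l (z) = |p_l (z)|], and apply Cauchy's estimate on [|t| = 1/(m-1)],
   the radius minimizing [(1 + r)^m / r]. *)
Lemma sum_normc_mderiv_le n m (p : {mpoly C[n]}) (z : 'I_n -> C) :
  p \is m.+2.-homog -> (forall i, normc (z i) = 1) ->
  \sum_l normc (p^`M(l)).@[z] <=
    m.+2%:R * (1 + m.+1%:R^-1) ^+ m.+1 * polydisc_norm p.
Proof.
move=> hp z1; pose a l := (p^`M(l)).@[z].
(* Where [a l = 0] the quotient is 0, so in general only [normc (w l) <= 1] holds. *)
pose w l : C := (normc (a l))%:C / a l.
have wa l : w l * a l = (normc (a l))%:C.
  have [a0|a0] := eqVneq (a l) 0; first by rewrite a0 mulr0 normc0.
  by rewrite /w divfK.
have w1 l : normc (w l) <= 1.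
  rewrite /w normcM normcV normc_real ?normc_ge0 //.
  have [->|a0] := eqVneq (normc (a l)) 0; first by rewrite mul0r.
  by rewrite divff.
have [f fE f1] := line_restriction p z w.
pose r : R := m.+1%:R^-1; have r0 : 0 < r by rewrite invr_gt0 ltr0n.
have r1 : 0 < 1 + r by rewrite addr_gt0.
have : normc f`_1 * r ^+ 1 <= (1 + r) ^+ m.+2 * polydisc_norm p.
  apply: cauchy_coef => // t tr; rewrite fE; apply: normc_meval_le => // i.
  apply: le_trans (le_normcD _ _) _; rewrite z1 lerD2l normcM tr.
  by rewrite ler_piMr // ltW.
have -> : normc f`_1 = \sum_l normc (a l).
  rewrite f1; under eq_bigr do rewrite wa.
  by rewrite -rmorph_sum normc_real // sumr_ge0 // => l _; exact: normc_ge0.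
rewrite expr1 -ler_pdivlMr // => /le_trans; apply.
rewrite le_eqVlt; apply/orP; left; apply/eqP.
(* For [r = 1 / (m + 1)] one has [(1 + r) / r = m + 2], which absorbs one factor [1 + r]. *)
rewrite /r invrK exprS -[m.+2%:R]natr1.
have mn0 : m.+1%:R != 0 :> R by rewrite pnatr_eq0.
set x := (1 + _) ^+ _; set y := polydisc_norm _; field.
by rewrite addrC natr1.
Qed.

(** * Coefficient sums of a polynomial and of its partial derivatives *)

Lemma ler_sum_subset (T : eqType) (s r : seq T) (F : T -> R) :
  uniq s -> uniq r -> {subset s <= r} -> (forall y, 0 <= F y) ->
  \sum_(y <- s) F y <= \sum_(y <- r) F y.
Proof.
move=> us ur sr F0; rewrite [leRHS](bigID (mem s)) /= ler_wpDr ?sumr_ge0 //.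
rewrite -[leRHS]big_filter le_eqVlt; apply/orP; left; apply/eqP.
apply: perm_big; apply: uniq_perm; rewrite ?filter_uniq // => y.
by rewrite mem_filter; case: (boolP (y \in s)) => //= /sr.
Qed.

(** On monomials containing the variable [l], the map [a |-> a - U_(l)] is injective into the
    support of the derivative, whose coefficient there is [a l] times that of [p]. *)
Lemma sum_mderiv_coef_le n (p : {mpoly C[n]}) l :
  \sum_(a <- msupp p) ((a : 'X_{1..n}) l)%:R * normc p@_a <= Defs.coef_sum (p^`M(l)).
Proof.
pose s := [seq a <- msupp p | (0 < (a : 'X_{1..n}) l)%N].
have sub (a : 'X_{1..n}) : a \in s -> (a - U_(l) + U_(l) = a)%MM.
  by rewrite mem_filter => /andP[al _]; rewrite submK // lep1mP -lt0n.
have -> : \sum_(a <- msupp p) ((a : 'X_{1..n}) l)%:R * normc p@_a =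
    \sum_(b <- [seq (a - U_(l))%MM | a <- s]) normc (p^`M(l))@_b.
  rewrite [RHS]big_map [LHS](bigID (fun a : 'X_{1..n} => (0 < a l)%N)) /=.
  rewrite [X in _ + X]big1 ?addr0; last first.
    by move=> a; rewrite lt0n negbK => /eqP ->; rewrite mul0r.
  rewrite -big_filter !big_seq; apply: eq_bigr => a sa.
  rewrite mcoeff_deriv sub // normcMn mulr_natl; congr (_ *+ _).
  by rewrite -{1}(sub _ sa) mnmDE mnm1E eqxx addn1.
apply: ler_sum_subset; rewrite ?msupp_uniq //; last by move=> b; exact: normc_ge0.
  rewrite map_inj_in_uniq ?filter_uniq // => a b sa sb ab.
  by rewrite -(sub _ sa) ab sub.
move=> _ /mapP[a sa ->]; rewrite mcoeff_msupp mcoeff_deriv sub //.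
rewrite -mulr_natr mulf_neq0 ?pnatr_eq0 // -mcoeff_msupp.
by move: sa; rewrite mem_filter => /andP[].
Qed.

(** Euler's identity on coefficients: the exponents of each monomial add up to [m]. *)
Lemma coef_sum_mderiv n m (p : {mpoly C[n]}) : p \is m.-homog ->
  m%:R * Defs.coef_sum p <= \sum_l Defs.coef_sum (p^`M(l)).
Proof.
move=> hp; apply: le_trans (ler_sum _ (fun l _ => sum_mderiv_coef_le p l)).
rewrite exchange_big mulr_sumr le_eqVlt; apply/orP; left; apply/eqP.
rewrite !big_seq; apply: eq_bigr => a ap; rewrite -mulr_suml; congr (_ * _).
by rewrite -(dhomog_mf hp ap : mdeg a = m) mdegE natr_sum.
Qed.

(** Cauchy-Schwarz against the constant 1; the binomial counts the monomials of degree [d] in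
    [n + 1] variables. *)
Lemma coef_sum_le_l2 n d (q : {mpoly C[n.+1]}) : q \is d.-homog ->
  Defs.coef_sum q <= Num.sqrt 'C(d + n, d)%:R *
                Num.sqrt (\sum_(a <- msupp q) normc q@_a ^+ 2).
Proof.
move=> hq; have S0 : 0 <= \sum_(a <- msupp q) normc q@_a ^+ 2.
  by apply: sumr_ge0 => a _; exact: sqr_ge0.
rewrite -sqrtrM ?ler0n // -[leLHS]ger0_norm ?coef_sum_ge0 // -sqrtr_sqr.
rewrite ler_sqrt ?mulr_ge0 //.
have := cauchy_schwarz (msupp q) (fun=> 1) (fun a => normc q@_a).
under [in leLHS]eq_bigr do rewrite mul1r.
rewrite -/(Defs.coef_sum q) => /le_trans; apply; apply: ler_wpM2r => //.
rewrite expr1n big_const_seq count_predT iter_addr_0 ler_nat -size_basis.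
apply: uniq_leq_size; first exact: msupp_uniq.
by move=> a aq; rewrite -basis_cover (dhomog_mf hq aq : mdeg a = d).
Qed.

Lemma coef_sum_bound n m (p : {mpoly C[n.+1]}) : p \is m.+2.-homog ->
  Defs.coef_sum p <= Num.sqrt 'C(m.+1 + n, m.+1)%:R * Num.sqrt 2 ^+ m.+1 *
    (1 + m.+1%:R^-1) ^+ m.+1 * polydisc_norm p.
Proof.
move=> hp; pose q l := p^`M(l).
have hq l : q l \is m.+1.-homog.
  apply/dhomogP => a; rewrite mcoeff_msupp mcoeff_deriv => aq.
  have : (a + U_(l))%MM \in msupp p.
    by rewrite mcoeff_msupp; apply: contra aq => /eqP ->; rewrite mul0rn.
  by move=> /(dhomog_mf hp) /eqP; rewrite /= mdegD mdeg1 addn1 eqSS => /eqP.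
pose B l := Num.sqrt (\sum_(a <- msupp (q l)) normc (q l)@_a ^+ 2).
(* The left side bounds from below a torus mean of the sum of the moduli of the [q l]; the right
   side bounds that sum at each point of the torus. *)
have l2 : Num.sqrt (2^-1 ^+ m.+1) * \sum_l B l <=
    m.+2%:R * (1 + m.+1%:R^-1) ^+ m.+1 * polydisc_norm p.
  rewrite mulr_sumr; under eq_bigr do
    rewrite -sqrtrM ?exprn_ge0 ?invr_ge0 ?ler0n //.
  apply: torus_mean_ub (torus_mean_sum (index_enum 'I_n.+1)
    (fun l => torus_mean_mpoly (hq l))) => s /andP[/eqP ns /allP s1].
  apply: sum_normc_mderiv_le => // i; apply/eqP/s1/mem_nth.
  by rewrite ns.
have r2 : Num.sqrt 2 ^+ m.+1 * Num.sqrt (2^-1 ^+ m.+1) = 1 :> R.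
  rewrite -[Num.sqrt 2 ^+ _]ger0_norm ?exprn_ge0 ?sqrtr_ge0 // -sqrtr_sqr.
  rewrite -sqrtrM ?sqr_ge0 // exprAC sqr_sqrtr ?ler0n // -exprMn.
  by rewrite divff ?pnatr_eq0 // expr1n sqrtr1.
have sB : \sum_l B l <= Num.sqrt 2 ^+ m.+1 *
    (m.+2%:R * (1 + m.+1%:R^-1) ^+ m.+1 * polydisc_norm p).
  rewrite -[leLHS]mul1r -[X in X * _ <= _]r2 -[leLHS]mulrA ler_wpM2l //.
  by rewrite exprn_ge0 ?sqrtr_ge0.
have m0 : 0 < m.+2%:R :> R by rewrite ltr0n.
(* The factor [m + 2] from Euler's identity cancels the one in the gradient bound. *)
rewrite -(ler_pM2l m0); apply: le_trans (coef_sum_mderiv hp) _.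
apply: le_trans (ler_sum _ (fun l _ => coef_sum_le_l2 (hq l))) _.
rewrite -mulr_sumr; apply: le_trans (ler_wpM2l _ sB) _; first exact: sqrtr_ge0.
by rewrite le_eqVlt; apply/orP; left; apply/eqP; ring.
Qed.

(** * Comparison of two neighbouring binomial coefficients *)

Lemma bin_le_expn a d : ('C(a, d) <= a ^ d)%N.
Proof.
elim: d => [|d IH]; first by rewrite bin0.
apply: (@leq_trans (d.+1 * 'C(a, d.+1))); first by rewrite leq_pmull.
by rewrite mul_bin_left expnS leq_mul // leq_subr.
Qed.

(** Since [(d + 1) 'C(d + n + 1, d + 1) = (d + n + 1) 'C(d + n, d)], cancelling ['C(d + n, d) ^ d]
    leaves ['C(d + n, d) <= (d + 1) (d + n + 1) ^ d]. *)
Lemma bin_power_le n d :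
  ('C(d + n, d) ^ d.+1 <= d.+1 ^ d.+1 * 'C((d + n).+1, d.+1) ^ d)%N.
Proof.
rewrite expnS [(d.+1 ^ d.+1)%N]expnS -mulnA -expnMn -mul_bin_diag expnMn mulnA.
rewrite leq_mul2r; apply/orP; right; apply: leq_trans (bin_le_expn _ _) _.
apply: leq_trans (leq_pmull _ _) => //.
by case: d => // d; rewrite leq_exp2r.
Qed.

Lemma powR_natX (c k : nat) (x : R) :
  ((c ^ k)%:R : R) `^ x = c%:R `^ (k%:R * x).
Proof. by rewrite natrX -powR_mulrn ?ler0n // -powRrM. Qed.

(** This is [bin_power_le] at [d = m + 1], raised to the power [1 / (2 (m + 2))]. *)
Lemma sqrt_bin_le n m : Num.sqrt 'C(m.+1 + n, m.+1)%:R <=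
  Num.sqrt m.+2%:R *
  ('C((m.+1 + n).+1, m.+2)%:R : R) `^ ((m.+2%:R - 1) / (2 * m.+2%:R)).
Proof.
have m0 : m.+2%:R != 0 :> R by rewrite pnatr_eq0.
have := bin_power_le n m.+1.
move: 'C(_, _) 'C(_, _) => a b ab.
have root (c : nat) : Num.sqrt c%:R =
    ((c ^ m.+2)%:R : R) `^ (2 * m.+2%:R)^-1.
  rewrite -powR12_sqrt ?ler0n // powR_natX; congr (_ `^ _).
  by rewrite invfM mulrCA divff ?mulr1.
have -> : m.+2%:R - 1 = m.+1%:R :> R by rewrite -[m.+2%:R]natr1 addrK.
rewrite !root -powR_natX.
rewrite -powRM ?ler0n //; apply: ge0_ler_powR.
- by rewrite invr_ge0 mulr_ge0 ?ler0n.
- by rewrite nnegrE ler0n.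
- by rewrite nnegrE mulr_ge0 ?ler0n.
by rewrite -natrM ler_nat.
Qed.

End SidonBound.

Theorem corollary1 (R : realType) (m n : nat) (hm : (1 < m)%N) (hn : (1 < n)%N) :
  sidon_constant R m n <=
    (1 + 1 / (m%:R - 1)) ^+ (m - 1) * Num.sqrt m%:R * Num.sqrt 2 ^+ (m - 1)
    * ('C(n + m - 1, m)%:R : R) `^ ((m%:R - 1) / (2 * m%:R)).
Proof.
(* The Sidon constant is the least admissible constant, so it is enough that the right side is
   admissible. *)
have [_ lb] := sidon_constantP R m (ltnW hn).
apply: lb; case: m hm => [|[|m]] // _; case: n hn => [|n] // _ p hp.
apply: le_trans (coef_sum_bound hp) _; apply: ler_wpM2r.
  exact: polydisc_norm_ge0.
have -> : 1 + 1 / (m.+2%:R - 1) = 1 + m.+1%:R^-1 :> R.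
  by rewrite div1r -[m.+2%:R]natr1 addrK.
have -> : (n.+1 + m.+2 - 1 = (m.+1 + n).+1)%N by lia.
rewrite subn1 /= [leLHS]mulrC -[leRHS]mulrA -[leRHS]mulrA.
apply: ler_wpM2l; first by rewrite exprn_ge0 ?addr_ge0 ?invr_ge0 ?ler0n.
rewrite [leRHS]mulrCA [leLHS]mulrC; apply: ler_wpM2l.
  by rewrite exprn_ge0 ?sqrtr_ge0.
exact: sqrt_bin_le.
Qed.
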